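(* For $n\geq 0$ let $a_n$ be the number of weakly even-up Catalan words of length $n$ and $b_n$ the number of weakly odd-up Catalan words of length $n$, and let $A(x)=\sum_{n\geq 0}a_nx^n$, $B(x)=\sum_{n\geq 0}b_nx^n$. Then \[A(x)=\frac{1-x-\sqrt{(1+x^2)^2-4x}}{x},\qquad B(x)=-\frac{x^3+2x^2+x-2+(x+2)\sqrt{(1+x^2)^2-4x}}{2x}.\]
   Context: A Catalan word of length $n$ is a word $w_1\cdots w_n\in\{1,\ldots,n\}^n$ with $w_1=1$ and $w_{i+1}\leq w_i+1$ for every $i\in\{1,\ldots,n-1\}$; for $n=0$ the empty word is the unique Catalan word. A word $w_1\cdots w_n$ is weakly even-up if for every $i\in\{1,\ldots,n-1\}$, whenever $w_i$ is even, $w_{i+1}\geq w_i$; it is weakly odd-up if for every $i\in\{1,\ldots,n-1\}$, whenever $w_i$ is odd, $w_{i+1}\geq w_i$. The square roots denote the power series branch with constant term $1$. *)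

(* Defs.v *)
From HB Require Import structures.
From mathcomp Require Import all_boot all_order all_algebra.
From mathcomp Require Import boolp.

Set Implicit Arguments.
Unset Strict Implicit.
Unset Printing Implicit Defensive.

Import GRing.Theory.

(** * Formal power series over a field *)

Local Open Scope ring_scope.

(* A record rather than a plain [nat -> R], so that the Cauchy product is never
   confused with the pointwise product of functions. *)
Record fps (R : fieldType) := Fps { fps_coef : nat -> R }.

HB.instance Definition _ (R : fieldType) := gen_eqMixin (fps R).
HB.instance Definition _ (R : fieldType) := gen_choiceMixin (fps R).

Section FpsRing.
Variable R : fieldType.
Implicit Types f g h : fps R.
Local Notation coef := (@fps_coef R).

Lemma fpsP f g : (forall n, coef f n = coef g n) -> f = g.
Proof. by case: f g => [f] [g] /= fg; congr Fps; apply/funext. Qed.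

Definition fps_zero : fps R := Fps (fun=> 0).
Definition fps_one : fps R := Fps (fun n => (n == 0)%:R).
Definition fps_opp f : fps R := Fps (fun n => - coef f n).
Definition fps_add f g : fps R := Fps (fun n => coef f n + coef g n).
Definition fps_mul f g : fps R :=
  Fps (fun n => \sum_(i < n.+1) coef f i * coef g (n - i)).

Lemma fps_addA : associative fps_add.
Proof. by move=> f g h; apply: fpsP => n /=; rewrite addrA. Qed.
Lemma fps_addC : commutative fps_add.
Proof. by move=> f g; apply: fpsP => n /=; rewrite addrC. Qed.
Lemma fps_add0 : left_id fps_zero fps_add.
Proof. by move=> f; apply: fpsP => n /=; rewrite add0r. Qed.
Lemma fps_addN : left_inverse fps_zero fps_opp fps_add.
Proof. by move=> f; apply: fpsP => n /=; rewrite addNr. Qed.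

HB.instance Definition _ :=
  GRing.isZmodule.Build (fps R) fps_addA fps_addC fps_add0 fps_addN.

Definition fps_trunc (n : nat) f : {poly R} := \poly_(i < n) coef f i.

Lemma coef_fps_trunc n f k : (k < n)%N -> (fps_trunc n f)`_k = coef f k.
Proof. by rewrite coef_poly => ->. Qed.

Lemma fps_mul_trunc n f g k : (k < n)%N ->
  coef (fps_mul f g) k = (fps_trunc n f * fps_trunc n g)`_k.
Proof.
move=> kn; rewrite coefM /=; apply: eq_bigr => i _.
have ik : (i <= k)%N by rewrite -ltnS.
rewrite !coef_fps_trunc ?(leq_ltn_trans ik) //.
exact: leq_ltn_trans (leq_subr _ _) kn.
Qed.

Lemma fps_mulC : commutative fps_mul.
Proof.
by move=> f g; apply: fpsP => n; rewrite !(fps_mul_trunc _ _ (ltnSn n)) mulrC.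
Qed.

Lemma fps_mulA : associative fps_mul.
Proof.
move=> f g h; apply: fpsP => n.
transitivity ((fps_trunc n.+1 f * fps_trunc n.+1 g * fps_trunc n.+1 h)`_n).
  rewrite -mulrA coefM; apply: eq_bigr => i _.
  rewrite coef_fps_trunc //; congr (_ * _).
  by rewrite -fps_mul_trunc // ltnS leq_subr.
rewrite coefM; apply: eq_bigr => i _.
rewrite coef_fps_trunc ?ltnS ?leq_subr //; congr (_ * _).
by rewrite -fps_mul_trunc.
Qed.

Lemma fps_mul1 : left_id fps_one fps_mul.
Proof.
move=> f; apply: fpsP => n /=; rewrite big_ord_recl /= subn0 mul1r big1 ?addr0 //.
by move=> i _; rewrite mul0r.
Qed.

Lemma fps_mulDl : left_distributive fps_mul fps_add.
Proof.
move=> f g h; apply: fpsP => n /=; rewrite -big_split /=.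
by apply: eq_bigr => i _; rewrite mulrDl.
Qed.

Lemma fps_one_neq0 : fps_one != fps_zero.
Proof.
by apply/eqP => /(congr1 (fun f => coef f 0))/eqP; rewrite /= oner_eq0.
Qed.

HB.instance Definition _ := GRing.Zmodule_isComNzRing.Build (fps R)
  fps_mulA fps_mulC fps_mul1 fps_mulDl fps_one_neq0.

Lemma fps_coef0 n : coef 0 n = 0. Proof. by []. Qed.
Lemma fps_coef1 n : coef 1 n = (n == 0)%:R. Proof. by []. Qed.
Lemma fps_coefN f n : coef (- f) n = - coef f n. Proof. by []. Qed.
Lemma fps_coefD f g n : coef (f + g) n = coef f n + coef g n.
Proof. by []. Qed.
Lemma fps_coefM f g n :
  coef (f * g) n = \sum_(i < n.+1) coef f i * coef g (n - i).
Proof. by []. Qed.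

Definition fps_unit : {pred fps R} := fun f => `[< exists g, g * f = 1 >].
Definition fps_inv f : fps R :=
  if pselect (exists g, g * f = 1) is left h then projT1 (cid h) else f.

Lemma fps_mulVx : {in fps_unit, left_inverse 1 fps_inv *%R}.
Proof.
move=> f; rewrite unfold_in => /asboolP fU; rewrite /fps_inv.
by case: pselect => // h; case: cid.
Qed.

Lemma fps_unitPl f g : g * f = 1 -> fps_unit f.
Proof. by move=> gf; apply/asboolP; exists g. Qed.

Lemma fps_invr_out : {in [predC fps_unit], fps_inv =1 id}.
Proof.
move=> f; rewrite inE unfold_in => /asboolPn nU; rewrite /fps_inv.
by case: pselect.
Qed.

HB.instance Definition _ := GRing.ComNzRing_hasMulInverse.Build (fps R)
  fps_mulVx fps_unitPl fps_invr_out.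

Lemma fps_order f : f != 0 ->
  exists2 i, coef f i != 0 & forall k, (k < i)%N -> coef f k = 0.
Proof.
move=> f0; have exf : exists i, coef f i != 0.
  apply: contrapT => nex; move/eqP: f0; apply; apply: fpsP => n.
  by apply/eqP; apply: contrapT => /negP fn; apply: nex; exists n.
case: (ex_minnP exf) => i fi mini; exists i => // k ki.
by apply/eqP; apply: contraLR ki => /mini; rewrite -leqNgt.
Qed.

Lemma fps_integral : GRing.integral_domain_axiom (fps R).
Proof.
move=> f g fg0; apply/norP => -[/fps_order[i fi ltf] /fps_order[j gj ltg]].
have /eqP := congr1 (fun h => coef h (i + j)) fg0; rewrite fps_coefM.
have ilt : (i < (i + j).+1)%N by rewrite ltnS leq_addr.
rewrite (bigD1 (Ordinal ilt)) //= addKn big1 ?addr0 => [|k].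
  by rewrite mulf_eq0 (negPf fi) (negPf gj).
rewrite -val_eqE /= neq_ltn => /orP[/ltf->|ik]; first by rewrite mul0r.
rewrite (ltg (i + j - k)%N) ?mulr0 //.
by rewrite ltn_subLR ?ltn_add2r // -ltnS.
Qed.

HB.instance Definition _ :=
  GRing.ComUnitRing_isIntegral.Build (fps R) fps_integral.

Definition fpsX : fps R := Fps (fun n => (n == 1)%:R).

(* The branch of the square root with constant term 1; junk value 0 if there
   is none. *)
Definition fps_sqrt f : fps R :=
  if pselect (exists s : fps R, coef s 0 = 1 /\ s ^+ 2 = f) is left h
  then projT1 (cid h) else 0.

Section SqrtExists.
Variable f : fps R.

Fixpoint fps_sqrt_tab (n : nat) : seq R :=
  if n is m.+1 then
    let t := fps_sqrt_tab m in
    rcons t ((coef f n - \sum_(i < m) t`_i.+1 * t`_(m - i)) / 2%:R)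
  else [:: 1].

Lemma size_fps_sqrt_tab n : size (fps_sqrt_tab n) = n.+1.
Proof. by elim: n => //= n IHn; rewrite size_rcons IHn. Qed.

Lemma nth_fps_sqrt_tab n k : (k <= n)%N ->
  (fps_sqrt_tab n)`_k = (fps_sqrt_tab k)`_k.
Proof.
elim: n => [|n IHn]; first by rewrite leqn0 => /eqP->.
rewrite leq_eqVlt => /orP[/eqP->//|]; rewrite ltnS => kn.
by rewrite -IHn //= nth_rcons size_fps_sqrt_tab ltnS kn.
Qed.

Lemma fps_sqrt_exists : 2%:R != 0 :> R -> coef f 0 = 1 ->
  exists s : fps R, coef s 0 = 1 /\ s ^+ 2 = f.
Proof.
move=> nz2 f0; exists (Fps (fun n => (fps_sqrt_tab n)`_n)); split=> //.
apply: fpsP => -[|n]; rewrite expr2 fps_coefM.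
  by rewrite big_ord_recl big_ord0 /= addr0 mulr1 f0.
rewrite big_ord_recl big_ord_recr subn0 subnn.
have -> : \sum_(i < n)
    coef (Fps (fun n => (fps_sqrt_tab n)`_n)) (lift ord0 (widen_ord (leqnSn n) i)) *
    coef (Fps (fun n => (fps_sqrt_tab n)`_n))
      (n.+1 - lift ord0 (widen_ord (leqnSn n) i)) =
  \sum_(i < n) (fps_sqrt_tab n)`_i.+1 * (fps_sqrt_tab n)`_(n - i).
  apply: eq_bigr => i _; rewrite [fps_coef]lock /= -lock /bump /= add1n subSS.
  rewrite (nth_fps_sqrt_tab (ltn_ord i)).
  by rewrite (nth_fps_sqrt_tab (leq_subr i n)).
rewrite /= mul1r mulr1 nth_rcons size_fps_sqrt_tab ltnn eqxx.
set S := \sum_(i < n) _; rewrite addrCA addrC.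
by rewrite -mulr2n -[_ *+ _]mulr_natr divfK // subrK.
Qed.

End SqrtExists.

Lemma fps_sqrtP f : 2%:R != 0 :> R -> coef f 0 = 1 ->
  coef (fps_sqrt f) 0 = 1 /\ fps_sqrt f ^+ 2 = f.
Proof.
move=> nz2 f0; rewrite /fps_sqrt; case: pselect => [h|[]]; first by case: cid.
exact: fps_sqrt_exists.
Qed.

Lemma fps_sqrt_unique f s : 2%:R != 0 :> R ->
  coef s 0 = 1 -> s ^+ 2 = f -> s = fps_sqrt f.
Proof.
move=> nz2 s0 sf; have f0 : coef f 0 = 1.
  by rewrite -sf expr2 fps_coefM big_ord_recl big_ord0 /= s0 addr0 mulr1.
have [t0 tf] := fps_sqrtP nz2 f0.
have /eqP := sf; rewrite -{1}tf eqf_sqr => /orP[/eqP//|/eqP sN].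
have /eqP := congr1 (fun h => coef h 0) sN.
by rewrite fps_coefN s0 t0 -addr_eq0 (negPf nz2).
Qed.

End FpsRing.

Arguments fpsX {R}.

(** * Catalan words *)

Local Open Scope nat_scope.

(* The default value 1 of [head] makes the empty word Catalan. *)
Definition catalan (w : seq nat) : bool :=
  [&& all (fun a => 1 <= a <= size w) w, head 1 w == 1
    & sorted (fun a b => b <= a + 1) w].

Definition weakly_even_up (w : seq nat) : bool :=
  sorted (fun a b => ~~ odd a ==> (b >= a)) w.

Definition weakly_odd_up (w : seq nat) : bool :=
  sorted (fun a b => odd a ==> (b >= a)) w.

(* Tuples over 'I_n.+1 only serve to make the type of words finite: [catalan]
   excludes the letter 0. *)
Definition num_catalan (P : pred (seq nat)) (n : nat) : nat :=
  #|[set w : n.-tuple 'I_n.+1 |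
      catalan (map val w) && P (map val w)]|.

Definition num_weakly_even_up : nat -> nat := num_catalan weakly_even_up.
Definition num_weakly_odd_up : nat -> nat := num_catalan weakly_odd_up.

Local Open Scope ring_scope.

Definition gen_fun (a : nat -> nat) : fps rat := Fps (fun n => (a n)%:R).

(* Main.v *)
(* Read a Catalan word as a walk on letters started from a virtual letter 0, and
   let F_k be the generating function of the continuations after the letter k.
   The series F_k satisfy F_k = 1 + x * sum F_j, with j over the letters allowed
   after k, and this infinite linear system has only one solution. Consecutive
   differences turn it into a linear recurrence with constant coefficients in
   k/2, solved by geometric progressions whose ratio is
   lambda = P * (P - x), where P = (1 + x^2 - r) / (2x) is the power series
   root of x * P^2 - (1 + x^2) * P + 1 = 0; the wanted series is F_0. *)
Require Import Defs.
From HB Require Import structures.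
From mathcomp Require Import all_boot all_order all_algebra.
From mathcomp Require Import ring zify.

Import GRing.Theory.
Local Open Scope ring_scope.

(** * Coefficients and divisibility by [fpsX] *)

Section PowerSeries.
Variable K : fieldType.
Implicit Types f g : fps K.

Lemma fps_coefXM f n :
  fps_coef (fpsX * f) n = if n is m.+1 then fps_coef f m else 0.
Proof.
rewrite fps_coefM; case: n => [|n].
  by rewrite big_ord_recl big_ord0 /= mul0r addr0.
rewrite !big_ord_recl big1 ?addr0 /= => [|i _]; last by rewrite mul0r.
by rewrite mul0r mul1r add0r subSS subn0.
Qed.

Lemma fps_coefM0 f g : fps_coef (f * g) 0 = fps_coef f 0 * fps_coef g 0.
Proof. by rewrite fps_coefM big_ord_recl big_ord0 addr0. Qed.

Lemma fps_coef_sum (I : Type) (s : seq I) (Q : pred I) (F : I -> fps K) n :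
  fps_coef (\sum_(i <- s | Q i) F i) n = \sum_(i <- s | Q i) fps_coef (F i) n.
Proof. exact: (big_morph (fun f => fps_coef f n)). Qed.

Lemma fpsX_neq0 : fpsX != 0 :> fps K.
Proof.
apply/eqP => /(congr1 (fun f => fps_coef f 1))/eqP.
by rewrite fps_coef0 /= oner_eq0.
Qed.

Lemma fpsX_factor f : fps_coef f 0 = 0 -> exists g, f = fpsX * g.
Proof.
move=> f0; exists (Fps (fun n => fps_coef f n.+1)).
by apply: fpsP => -[|n]; rewrite fps_coefXM.
Qed.

Lemma fps_geom : exists s : fps K, (1 - fpsX) * s = 1.
Proof.
exists (Fps (fun=> 1)); apply: fpsP => n.
rewrite mulrBl mul1r fps_coefD fps_coefN fps_coefXM fps_coef1.
by case: n => [|n] /=; rewrite ?subr0 ?subrr.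
Qed.

End PowerSeries.

(** * Catalan words as walks, and the linear system for their continuations *)

Section Continuations.
Variable q : pred nat.

(** The target 0 is forbidden, so 0 occurs only as the virtual start; there the condition from [q]
    is vacuous. *)
Definition step (a b : nat) : bool := [&& 0 < b, b <= a.+1 & q a ==> (a <= b)]%N.

Fixpoint num_continuations (k n : nat) : nat :=
  if n is m.+1 then (\sum_(j < k.+2 | step k j) num_continuations j m)%N else 1%N.

(** Each step climbs by at most 1, so [k + n < N] makes the alphabet large enough for every walk;
    the induction splits off the first letter. *)
Lemma card_step_path N k n : (k + n < N)%N ->
  #|[set w : n.-tuple 'I_N | path step k (map val w)]| = num_continuations k n.
Proof.
elim: n k => [|n IHn] k kN /=.
  rewrite (_ : [set _ | _] = [set: 0.-tuple 'I_N]) ?cardsT ?card_tuple ?expn0 //.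
  by apply/setP => w; rewrite !inE tuple0.
rewrite -sum1dep_card.
rewrite (reindex (fun p : 'I_N * n.-tuple 'I_N => cons_tuple p.1 p.2)) /=; last first.
  exists (fun t => (thead t, [tuple of behead t])) => [[i t] _|t _] /=.
    by congr pair; apply: val_inj.
  by rewrite [in RHS](tuple_eta t); apply: val_inj.
rewrite -(pair_big_dep (fun i : 'I_N => step k i)
  (fun i (t : n.-tuple 'I_N) => path step i (map val t)) (fun _ _ => 1%N)) /=.
rewrite (big_ord_widen_cond N (step k) (fun j => num_continuations j n)); last by lia.
apply: eq_big => [i|i /and3P[_ ik _]].
  by rewrite /step ltnS; case: (i <= k.+1)%N; rewrite ?andbT ?andbF.
by rewrite sum1dep_card IHn //; lia.
Qed.

Lemma step_path_bound k w : path step k w ->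
  all (fun a => 0 < a <= k + size w)%N w.
Proof.
elim: w k => //= b w IHw k /andP[/and3P[b0 bk _] /IHw wb].
rewrite b0 /=; apply/andP; split; first by lia.
by apply: sub_all wb => a /andP[-> /=]; lia.
Qed.

Lemma step_pathE k w : path step k w =
  [&& all (fun a => 0 < a)%N w, path (fun a b => b <= a + 1)%N k w
    & path (fun a b => q a ==> (a <= b)%N) k w].
Proof.
elim: w k => //= b w IHw k; rewrite IHw /step addn1.
case: (0 < b)%N => //=; case: (b <= k.+1)%N; rewrite ?andbF //=.
by case: (q k ==> _); rewrite ?andbF.
Qed.

(** A first step from 0 must reach 1, and [step_path_bound] at [k = 0] gives the upper bound on
    letters. *)
Lemma catalan_step_path w :
  catalan w && sorted (fun a b => q a ==> (a <= b)%N) w = path step 0 w.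
Proof.
apply/idP/idP.
  case: w => //= a w /andP[/and3P[/= /andP[_ wpos] /eqP-> up] qw].
  rewrite step_pathE up qw !andbT {1}/step /= implybT /=.
  by apply: sub_all wpos => c /andP[].
move=> pw; have := step_path_bound _ _ pw.
case: w pw => //= a w /andP[/and3P[a0 a1 _]].
rewrite step_pathE => /and3P[_ up qw] wb.
by rewrite /catalan /= up qw !andbT; apply/andP; split => //; apply/eqP; lia.
Qed.

Lemma num_catalan_continuations n :
  num_catalan (sorted (fun a b => q a ==> (a <= b)%N)) n = num_continuations 0 n.
Proof.
rewrite -(card_step_path n.+1) //.
by apply: eq_card => w; rewrite !inE catalan_step_path.
Qed.

Lemma sum_step (V : nmodType) (F : nat -> V) k :
  \sum_(j < k.+2 | step k j) F j =
  if q k && (0 < k)%N then F k + F k.+1 else \sum_(j < k.+1) F j.+1.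
Proof.
rewrite big_mkcond big_ord_recl {1}/step /= add0r.
case: ifP => [/andP[]|/negbT qk].
  case: k => // k qk _; rewrite !big_ord_recr /= big1 ?add0r => [|i _].
    by rewrite /step /bump /= !add1n qk !ltnS leqnn leqnSn.
  by rewrite /step /bump /= qk add1n ltnS [(k < _)%N]ltnNge ltn_ord andbF.
have free m : q k ==> (k <= m)%N.
  by case: (q k) qk => //=; rewrite -eqn0Ngt => /eqP->.
by apply: eq_bigr => i _; rewrite /step /bump /= add1n free andbT ltnS -ltnS ltn_ord.
Qed.

Variables (K : fieldType) (F : nat -> fps K).
Hypothesis q_alternates : forall k, q k.+1 = ~~ q k.
Hypothesis F_start : F 0 = 1 + fpsX * F 1.
Hypothesis F_odd_start : ~~ q 1 -> F 1 = 1 + fpsX * (F 1 + F 2).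
Hypothesis F_up : forall k, q k.+1 -> F k.+1 = 1 + fpsX * (F k.+1 + F k.+2).
Hypothesis F_free : forall k, ~~ q k.+2 ->
  F k.+2 = F k + fpsX * (F k.+2 + F k.+3).

(** [F_free] is the difference of these equations at [k.+2] and [k]. As [q] alternates, both letters
    are free, and induction by steps of two telescopes. *)
Lemma free_sum k : ~~ q k -> F k = 1 + fpsX * \sum_(j < k.+1) F j.+1.
Proof.
elim/ltn_ind: k => -[|[|k]] IHk qk.
- by rewrite big_ord_recl big_ord0 addr0.
- by rewrite !big_ord_recl big_ord0 addr0; apply: F_odd_start.
rewrite F_free // !(big_ord_recr k.+2) (big_ord_recr k.+1) /=.
have qk0 : ~~ q k by move: qk; rewrite !q_alternates negbK.
by rewrite (IHk k (ltnW (ltnSn _)) qk0); ring.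
Qed.

Lemma continuations_system k : F k = 1 + fpsX * \sum_(j < k.+2 | step k j) F j.
Proof.
rewrite sum_step; case: ifPn => [/andP[]|]; first by case: k => // k /F_up.
rewrite negb_and -eqn0Ngt => /orP[/free_sum//|/eqP->].
by rewrite big_ord_recl big_ord0 addr0.
Qed.

(** Uniqueness for the system: the factor [fpsX] makes coefficient [n.+1] depend only on
    coefficients [n]. *)
Lemma continuations_gf k n : fps_coef (F k) n = (num_continuations k n)%:R.
Proof.
elim: n k => [|n IHn] k; rewrite continuations_system fps_coefD fps_coefXM fps_coef1.
  by rewrite addr0.
rewrite add0r fps_coef_sum natr_sum.
by apply: eq_bigr => j _; rewrite IHn.
Qed.

End Continuations.

Lemma gen_fun_catalan (q : pred nat) (F : nat -> fps rat) :
    (forall k, q k.+1 = ~~ q k) ->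
    F 0 = 1 + fpsX * F 1 ->
    (~~ q 1 -> F 1 = 1 + fpsX * (F 1 + F 2)) ->
    (forall k, q k.+1 -> F k.+1 = 1 + fpsX * (F k.+1 + F k.+2)) ->
    (forall k, ~~ q k.+2 -> F k.+2 = F k + fpsX * (F k.+2 + F k.+3)) ->
  gen_fun (num_catalan (sorted (fun a b => q a ==> (a <= b)%N))) = F 0.
Proof.
move=> q_alt F0 F1 F_up F_free; apply: fpsP => n.
by rewrite /= num_catalan_continuations (continuations_gf q).
Qed.

(** Certificate format: given the cofactor [c], an equality modulo a relation becomes a plain ring
    identity. *)
Lemma eq_of_sub (R : comNzRingType) (c a b u v : R) :
  a = b -> u - v = c * (a - b) -> u = v.
Proof. by move=> ->; rewrite subrr mulr0 => /eqP; rewrite subr_eq0 => /eqP. Qed.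

Arguments eq_of_sub {R} c {a b u v}.

(** * Geometric solutions of the recurrences, with [s] for 1/(1-x) *)

Section Solution.
Variables (R : comNzRingType) (x s p : R).
Hypothesis s_inv : (1 - x) * s = 1.
Hypothesis p_root : x * p ^+ 2 = (1 + x ^+ 2) * p - 1.

Definition ratio : R := p * (p - x).
Local Notation lambda := ratio.

(* No letter 0 ever follows the virtual letter 0, so the formula for positive
   even letters fails at 0. *)
Definition even_up_gf k : R :=
  if k is 0%N then 1 - x + 2%:R * x * lambda
  else if odd k then 2%:R * lambda ^+ (k./2.+1) - 1
  else 1 + 2%:R * x * s * lambda ^+ (k./2.+1).

(** Even letters are free here, and 0, followed only by 1, fits their pattern; hence no exception at
    0. *)
Definition odd_up_gf k : R :=
  if odd k then 1 + x * s * (x + 2%:R) * (p - x) * lambda ^+ (k./2.+1)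
  else (x + 2%:R) * (p - x) * lambda ^+ (k./2) - 1.

(** Characteristic equation of the recurrence on free letters, once the constrained ones are
    eliminated. *)
Lemma ratio_root : x ^+ 2 * s * lambda ^+ 2 = (1 - x) * lambda - 1.
Proof.
have D : x ^+ 2 * lambda ^+ 2 = (1 - x) ^+ 2 * lambda - (1 - x).
  by apply: (eq_of_sub (x * lambda + p + 1 - x) p_root); rewrite /ratio; ring.
apply: (eq_of_sub ((1 - x) * lambda - 1) s_inv).
transitivity (s * (x ^+ 2 * lambda ^+ 2) - ((1 - x) * lambda - 1)); first by ring.
by rewrite D; ring.
Qed.

(** Equivalently, [p - x] is the inverse of [1 - x ^+ 2 * s * lambda], which is what the equation at
    0 demands of the amplitude in [odd_up_gf]. *)
Lemma ratio_start : x ^+ 2 * s * (p - x) * lambda = p - x - 1.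
Proof.
have D : x ^+ 2 * (p - x) * lambda = (1 - x) * (p - x - 1).
  by apply: (eq_of_sub (x * (p - x) + 1) p_root); rewrite /ratio; ring.
apply: (eq_of_sub (p - x - 1) s_inv).
transitivity (s * (x ^+ 2 * (p - x) * lambda) - (p - x - 1)); first by ring.
by rewrite D; ring.
Qed.

Lemma even_up_start : even_up_gf 0 = 1 + x * even_up_gf 1.
Proof. by rewrite /=; ring. Qed.

Lemma even_up_odd_start :
  even_up_gf 1 = 1 + x * (even_up_gf 1 + even_up_gf 2).
Proof.
by apply: (eq_of_sub (-2%:R) ratio_root); rewrite /=; ring.
Qed.

Lemma even_up_up k : odd k ->
  even_up_gf k.+1 = 1 + x * (even_up_gf k.+1 + even_up_gf k.+2).
Proof.
move=> k1; rewrite /even_up_gf /= k1 /= uphalf_half k1 add1n.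
apply: (eq_of_sub (2%:R * x * lambda ^+ (k./2.+2)) s_inv).
by move: (lambda ^+ _) => t; ring.
Qed.

Lemma even_up_free k : odd k ->
  even_up_gf k.+2 = even_up_gf k + x * (even_up_gf k.+2 + even_up_gf k.+3).
Proof.
(* An odd [k] is positive, so the exceptional value at 0 is not met. *)
case: k => // k /= k0; rewrite /even_up_gf /= !negbK k0.
rewrite uphalf_half (negPf k0) add0n !exprS.
apply: (eq_of_sub (- 2%:R * lambda * lambda ^+ k./2) ratio_root).
by move: (lambda ^+ _) => t; ring.
Qed.

Lemma odd_up_start : odd_up_gf 0 = 1 + x * odd_up_gf 1.
Proof.
apply: (eq_of_sub (- (x + 2%:R)) ratio_start).
by rewrite /odd_up_gf /=; ring.
Qed.

Lemma odd_up_up k : ~~ odd k ->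
  odd_up_gf k.+1 = 1 + x * (odd_up_gf k.+1 + odd_up_gf k.+2).
Proof.
move=> k0; rewrite /odd_up_gf /= negbK (negPf k0) /= uphalf_half (negPf k0) add0n.
apply: (eq_of_sub (x * (x + 2%:R) * (p - x) * lambda ^+ (k./2.+1)) s_inv).
by move: (lambda ^+ _) => t; ring.
Qed.

Lemma odd_up_free k : ~~ odd k ->
  odd_up_gf k.+2 = odd_up_gf k + x * (odd_up_gf k.+2 + odd_up_gf k.+3).
Proof.
move=> k0; rewrite /odd_up_gf /= !negbK (negPf k0) /= uphalf_half (negPf k0) add0n.
rewrite !exprS.
apply: (eq_of_sub (- (x + 2%:R) * (p - x) * lambda ^+ k./2) ratio_root).
by move: (lambda ^+ _) => t; ring.
Qed.

End Solution.

(** * The root [p] obtained from the square root, and the closed forms *)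

Lemma fps_sqrt_root :
  exists p : fps rat,
    fps_sqrt ((1 + fpsX ^+ 2) ^+ 2 - 4%:R * fpsX)
      = 1 + fpsX ^+ 2 - 2%:R * fpsX * p
    /\ fpsX * p ^+ 2 = (1 + fpsX ^+ 2) * p - 1.
Proof.
set r := fps_sqrt _; set x := fpsX.
have two_unit : 2%:R * (Fps (fun n => (n == 0)%N%:R / 2%:R)) = 1 :> fps rat.
  apply: fpsP => n; rewrite mulr_natl mulr2n fps_coefD fps_coef1 /=.
  by case: n => [|n] //=; rewrite mul0r addr0.
set h := Fps _ in two_unit.
have [r0 r2] : fps_coef r 0 = 1 /\ r ^+ 2 = (1 + x ^+ 2) ^+ 2 - 4%:R * x.
  apply: fps_sqrtP => //.
  rewrite fps_coefD fps_coefN !expr2 !fps_coefM0 !fps_coefD !fps_coefM0 fps_coef1.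
  by rewrite !mulr0 oppr0 !addr0 mulr1.
(* The branch with constant term 1 cancels the constant term, so division by [x] is possible; [h] is
   the constant 1/2. *)
have [g gE] : exists g, 1 + x ^+ 2 - r = x * g.
  apply: fpsX_factor; rewrite fps_coefD fps_coefN r0 fps_coefD expr2 fps_coefM0.
  by rewrite fps_coef1 mulr0 addr0 subrr.
have rE : r = 1 + x ^+ 2 - 2%:R * x * (h * g).
  apply: (eq_of_sub (x * g) two_unit).
  transitivity (x * (2%:R * h * g) - (1 + x ^+ 2 - r)); first by ring.
  by rewrite gE; ring.
exists (h * g); split=> //; move: (h * g) rE => p rE.
(* Multiplying the quadratic by [4%:R * x] completes the square and turns it into [r2]. *)
have x4 : 4%:R * x != 0.
  rewrite mulf_neq0 ?fpsX_neq0 //; apply/eqP => four0.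
  have : 2%:R * h * (2%:R * h) = 4%:R * (h * h) by ring.
  by rewrite four0 two_unit mulr1 mul0r => /eqP; rewrite oner_eq0.
apply: (mulfI x4); apply: (eq_of_sub 1 r2).
by rewrite rE; ring.
Qed.

(* The quotients are taken in the fraction field of the ring of power series. *)
Theorem theorem9 :
  let x : fps rat := fpsX in
  let r : fps rat := fps_sqrt ((1 + x ^+ 2) ^+ 2 - 4%:R * x) in
  let A : fps rat := gen_fun num_weakly_even_up in
  let B : fps rat := gen_fun num_weakly_odd_up in
  tofrac A = tofrac (1 - x - r) / tofrac x /\
  tofrac B =
    - (tofrac (x ^+ 3 + 2%:R * x ^+ 2 + x - 2%:R + (x + 2%:R) * r)
       / tofrac (2%:R * x)).
Proof.
move=> x r A B.
have [p [rE p_root]] := fps_sqrt_root; have [s s_inv] := fps_geom rat.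
have AE : A = even_up_gf _ x s p 0.
  apply: (gen_fun_catalan (fun a => ~~ odd a)) => [//| |_|k kodd|k kodd].
  - exact: even_up_start.
  - exact: even_up_odd_start.
  - by apply: even_up_up => //; apply: negbNE kodd.
  - by apply: even_up_free => //; rewrite -[odd k]negbK; apply: negbNE kodd.
have BE : B = odd_up_gf _ x s p 0.
  apply: (gen_fun_catalan odd) => [//| |//|k keven|k keven].
  - exact: odd_up_start.
  - exact: odd_up_up keven.
  - by apply: odd_up_free => //; rewrite -[odd k]negbK.
have x0 : tofrac x != 0 by rewrite tofrac_eq0 fpsX_neq0.
have x20 : tofrac (2%:R * x) != 0.
  rewrite tofrac_eq0 mulf_neq0 ?fpsX_neq0 //; apply/eqP.
  by move/(congr1 (fun f => fps_coef f 0))/eqP.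
split.
  apply/(canRL (mulfK x0)); rewrite -tofracM; congr tofrac.
  apply: (eq_of_sub (2%:R * x) p_root).
  by rewrite AE /r rE /even_up_gf /ratio -/x; ring.
rewrite -mulNr; apply/(canRL (mulfK x20)); rewrite -tofracM -tofracN; congr tofrac.
(* This value is linear in [p], so the quadratic relation does not enter. *)
by rewrite BE /r rE /odd_up_gf /= -/x; ring.
Qed.
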